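(* Let $f=f(x,y,p)$ and $h=h(x,y)$ be smooth functions and let $g_{\mathcal D_{f,h}}=2\theta^1\theta^5-2\theta^2\theta^4+(\theta^3)^2$ on (an open subset of) $\mathbb R^5$ with coordinates $(x,y,z,p,q)$, with the co-frame $$\begin{aligned}\theta^1&=dy-p\,dx,\qquad \theta^2=dz-(q^2+f+hz)\,dx-\tfrac{\sqrt2}{2}q\,\theta^3,\qquad\theta^3=2\sqrt2(dp-q\,dx),\qquad\theta^4=3\,dx,\\ \theta^5&=\tfrac{\sqrt2h}{2}\theta^3-6\,dq+3(2hq+f_p)\,dx+\tfrac1{10}\big(9f_{pp}+4h^2-6(ph_y+h_x)\big)\theta^1.\end{aligned}$$ The metric $$\tilde g_{\mathcal D_{f,h}}=2\,dt\,d(\varrho t)+t^2\big(g_{\mathcal D_{f,h}}+A(\theta^1)^2+2B\,\theta^1\theta^4+C(\theta^4)^2\big)$$ with $A=A(x,y,p,\varrho)$, $B=B(x,y,p,\varrho)$, $C=C(x,y,p,\varrho)$ is an ambient metric for the conformal class $[g_{\mathcal D_{f,h}}]$ if and only if $A,B,C$ satisfy the initial conditions $A|_{\varrho=0}\equiv0$, $B|_{\varrho=0}\equiv0$, $C|_{\varrho=0}\equiv0$ and the system of PDEs $$\begin{aligned}LA&=\tfrac9{40}f_{pppp},\\ LB&=-\tfrac1{36}A_p+\tfrac3{40}f_{ppp}+\tfrac9{20}h_y,\\ LC&=-\tfrac1{18}B_p+\tfrac1{324}A+\tfrac1{30}f_{pp}-\tfrac2{15}h^2+\tfrac15(ph_y+h_x),\end{aligned}$$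 where $L=2\varrho\frac{\partial^2}{\partial\varrho^2}-3\frac{\partial}{\partial\varrho}-\tfrac18\frac{\partial^2}{\partial p^2}$.
   Context: Subscripts denote partial derivatives; products of one-forms are symmetric products. $[g_{\mathcal D_{f,h}}]$ is the conformal class (signature $(3,2)$) canonically associated to the generic rank 2 distribution $\mathcal D_{f,h}=\mathrm{Span}(\partial_q,\ \partial_x+p\,\partial_y+q\,\partial_p+F\,\partial_z)$ with $F=q^2+f(x,y,p)+h(x,y)z$; it is represented by the metric $g_{\mathcal D_{f,h}}$ above. An ambient metric for a metric $g_0$ is a metric $2\,dt\,d(\varrho t)+t^2g(x^i,\varrho)$, with coordinates $t>0$ and $\varrho$ near $0$, such that $g(x^i,0)=g_0$ and its Ricci tensor vanishes. *)

(* Defs.v *)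
From HB Require Import structures.
From mathcomp Require Import all_boot all_order all_algebra.
From mathcomp Require Import all_classical all_reals all_analysis.
Set Implicit Arguments.
Unset Strict Implicit.
Unset Printing Implicit Defensive.
Import Order.TTheory GRing.Theory Num.Theory.
Import numFieldNormedType.Exports.
Local Open Scope classical_set_scope.
Local Open Scope ring_scope.

Section Calculus.
Variables (R : realType) (n : nat).
Implicit Types (D : set 'rV[R]_n) (F : 'rV[R]_n -> R).

Definition partial (i : 'I_n) F : 'rV[R]_n -> R :=
  fun x => 'D_(delta_mx 0 i) F x.

(* Iterated partial derivatives of all orders exist and are differentiable
   (hence continuous) on D; this is C^oo when D is open. *)
Definition smooth_on D F : Prop :=
  forall (s : seq 'I_n) (x : 'rV[R]_n), D x -> differentiable (foldr partial F s) x.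

End Calculus.

(* A field of bilinear forms on R^n is given by its matrix in the coordinate
   basis, a 1-form by its row of components. *)
Section Metrics.
Variables (R : realType) (n : nat).
Implicit Types (D : set 'rV[R]_n) (g : 'rV[R]_n -> 'M[R]_n).

(* Symmetric product of 1-forms, normalised by a . a = a (x) a. *)
Definition sprod (a b : 'rV[R]_n) : 'M[R]_n := 2^-1 *: (a^T *m b + b^T *m a).

(* Pseudo-Riemannian metrics, of arbitrary signature. *)
Definition metric_on D g : Prop :=
  (forall i j, smooth_on D (fun x => g x i j)) /\
  (forall x, D x -> (g x)^T = g x /\ g x \in unitmx).

(* christoffel g k i j is the function Gamma^k_(ij). *)
Definition christoffel g (k i j : 'I_n) (x : 'rV[R]_n) : R :=
  \sum_(l < n) invmx (g x) k l / 2 *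
    (partial i (fun y => g y l j) x + partial j (fun y => g y l i) x
     - partial l (fun y => g y i j) x).

Definition ricci g (x : 'rV[R]_n) : 'M[R]_n :=
  \matrix_(i, j)
    (\sum_(k < n) (partial k (christoffel g k i j) x
                   - partial j (christoffel g k i k) x)
     + \sum_(k < n) \sum_(l < n)
         (christoffel g k k l x * christoffel g l i j x
          - christoffel g k j l x * christoffel g l i k x)).

(* g' represents the conformal class [g0] on D. *)
Definition conformal_on D (g0 g' : 'rV[R]_n -> 'M[R]_n) : Prop :=
  exists u : 'rV[R]_n -> R,
    [/\ smooth_on D u, forall x, D x -> 0 < u x
      & forall x, D x -> g' x = u x *: g0 x].

End Metrics.

(* Ambient space: the coordinates of X : 'rV_(1 + n + 1) are (t, x^1, ..., x^n, rho). *)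
Section Ambient.
Variables (R : realType) (n : nat).
Implicit Types (U : set 'rV[R]_n) (W : set ('rV[R]_n * R)).
Implicit Types (g : 'rV[R]_n -> R -> 'M[R]_n).
Implicit Types (X : 'rV[R]_(1 + n + 1)) (G : 'rV[R]_(1 + n + 1) -> 'M[R]_(1 + n + 1)).

Definition amb_t X : R := lsubmx (lsubmx X) 0 0.
Definition amb_x X : 'rV[R]_n := rsubmx (lsubmx X).
Definition amb_rho X : R := rsubmx X 0 0.

Definition amb_dt : 'rV[R]_(1 + n + 1) := row_mx (row_mx 1%:M 0) 0.
Definition amb_drho : 'rV[R]_(1 + n + 1) := row_mx 0 1%:M.

(* Pull-back of a bilinear form along (t, x, rho) |-> x. *)
Definition amb_pull (M : 'M[R]_n) : 'M[R]_(1 + n + 1) :=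
  block_mx (block_mx 0 0 0 M) 0 0 0.

(* 2 dt d(rho t) + t^2 g(x, rho), with d(rho t) = rho dt + t drho. *)
Definition ambient_form g X : 'M[R]_(1 + n + 1) :=
  2 *: sprod amb_dt (amb_rho X *: amb_dt + amb_t X *: amb_drho)
  + amb_t X ^+ 2 *: amb_pull (g (amb_x X) (amb_rho X)).

(* The range of (x, rho), with rho near 0: a neighbourhood W of U x {0} in U x R.
   The ambient metric then lives on t > 0, (x, rho) in W. *)
Definition ambient_base U W : Prop :=
  [/\ open U, open W, forall x, U x -> W (x, 0)
    & forall x rho, W (x, rho) -> U x].

Definition ambient_dom W : set 'rV[R]_(1 + n + 1) :=
  [set X | 0 < amb_t X /\ W (amb_x X, amb_rho X)].

Definition ambient_metric U W (g0 : 'rV[R]_n -> 'M[R]_n) G : Prop :=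
  [/\ ambient_base U W,
      metric_on (ambient_dom W) G,
      (exists g, (forall X, ambient_dom W X -> G X = ambient_form g X) /\
                 (forall x, U x -> g x 0 = g0 x))
    & forall X, ambient_dom W X -> ricci G X = 0].

(* Ambient metric for the conformal class [g0]: for some metric in the class. *)
Definition ambient_metric_class U W (g0 : 'rV[R]_n -> 'M[R]_n) G : Prop :=
  exists g' : 'rV[R]_n -> 'M[R]_n, conformal_on U g0 g' /\ ambient_metric U W g' G.

End Ambient.

(* Indices of the coordinates (x, y, z, p, q) of R^5. *)
Definition ix : 'I_5 := @Ordinal 5 0 isT.
Definition iy : 'I_5 := @Ordinal 5 1 isT.
Definition iz : 'I_5 := @Ordinal 5 2 isT.
Definition ip : 'I_5 := @Ordinal 5 3 isT.
Definition iq : 'I_5 := @Ordinal 5 4 isT.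

Section Coframe.
Variable R : realType.
Implicit Types (f : 'rV[R]_3 -> R) (h : 'rV[R]_2 -> R) (A B C : 'rV[R]_4 -> R).
Implicit Types (m : 'rV[R]_5) (rho : R).

Definition xy m : 'rV[R]_2 := \row_(i < 2) [:: m 0 ix; m 0 iy]`_i.
Definition xyp m : 'rV[R]_3 := \row_(i < 3) [:: m 0 ix; m 0 iy; m 0 ip]`_i.
Definition xypr (w : 'rV[R]_5 * R) : 'rV[R]_4 :=
  \row_(i < 4) [:: w.1 0 ix; w.1 0 iy; w.1 0 ip; w.2]`_i.

Definition dh_x h := partial (@Ordinal 2 0 isT) h.
Definition dh_y h := partial (@Ordinal 2 1 isT) h.
Definition df_p f := partial (@Ordinal 3 2 isT) f.
Definition dA_p A := partial (@Ordinal 4 2 isT) A.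
Definition dA_rho A := partial (@Ordinal 4 3 isT) A.

(* dx, dy, dz, dp, dq according to the index. *)
Definition d5 (i : 'I_5) : 'rV[R]_5 := delta_mx 0 i.

Definition theta1 m : 'rV[R]_5 := d5 iy - m 0 ip *: d5 ix.

Definition theta3 m : 'rV[R]_5 := (2 * Num.sqrt 2) *: (d5 ip - m 0 iq *: d5 ix).

Definition theta2 f h m : 'rV[R]_5 :=
  d5 iz - (m 0 iq ^+ 2 + f (xyp m) + h (xy m) * m 0 iz) *: d5 ix
  - (Num.sqrt 2 / 2 * m 0 iq) *: theta3 m.

Definition theta4 : 'rV[R]_5 := 3 *: d5 ix.

Definition theta5 f h m : 'rV[R]_5 :=
  (Num.sqrt 2 * h (xy m) / 2) *: theta3 m - 6 *: d5 iq
  + (3 * (2 * h (xy m) * m 0 iq + df_p f (xyp m))) *: d5 ix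
  + (1 / 10 * (9 * df_p (df_p f) (xyp m) + 4 * h (xy m) ^+ 2
               - 6 * (m 0 ip * dh_y h (xy m) + dh_x h (xy m)))) *: theta1 m.

Definition gD f h m : 'M[R]_5 :=
  2 *: sprod (theta1 m) (theta5 f h m) - 2 *: sprod (theta2 f h m) theta4
  + sprod (theta3 m) (theta3 m).

(* A (theta^1)^2 + 2 B theta^1 theta^4 + C (theta^4)^2 is added to gD for every rho. *)
Definition gtilde f h A B C : 'rV[R]_(1 + 5 + 1) -> 'M[R]_(1 + 5 + 1) :=
  ambient_form (fun m rho =>
    gD f h m + A (xypr (m, rho)) *: sprod (theta1 m) (theta1 m)
    + (2 * B (xypr (m, rho))) *: sprod (theta1 m) theta4
    + C (xypr (m, rho)) *: sprod theta4 theta4).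

Definition Lop A (v : 'rV[R]_4) : R :=
  2 * v 0 (@Ordinal 4 3 isT) * dA_rho (dA_rho A) v - 3 * dA_rho A v
  - 1 / 8 * dA_p (dA_p A) v.

End Coframe.

(* Main.v *)
Require Import Defs.
From HB Require Import structures.
From Stdlib Require ZArith QArith.
From mathcomp Require Import all_boot all_order all_algebra.
From mathcomp Require Import all_classical all_reals all_analysis.
From mathcomp Require Import ssrZ ring lra.
Import Order.TTheory GRing.Theory Num.Theory.
Import numFieldNormedType.Exports.
Set Implicit Arguments.
Unset Strict Implicit.
Unset Printing Implicit Defensive.
Local Open Scope classical_set_scope.
Local Open Scope ring_scope.

(** In the coordinates (t, x, y, z, p, q, rho) the entries of the metric
    [gtilde] and of its inverse are polynomials in the coordinates, in 1/t and
    in the partial derivatives of f, h, A, B, C: the co-frame and the Gram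
    matrix of its dual frame have constant determinants.  The Ricci tensor can
    therefore be computed exactly by a verified calculus of differential
    polynomials, and it equals
      1/2 (E_A (theta^1)^2 + 2 E_B theta^1 theta^4 + E_C (theta^4)^2),
    where E_A, E_B, E_C are the differences of the two sides of the PDEs.
    Conversely, a metric g' = u g_D for which [gtilde] is ambient must have
    u = 1, as seen on the dp dp entry, where theta^1 and theta^4 vanish. *)

(** * Differential polynomials *)

Local Notation Q := QArith_base.Q.
Local Notation Qnum := QArith_base.Qnum.
Local Notation Qden := QArith_base.Qden.

(** Binary rationals of the standard library are used because they evaluate quickly in [vm_compute].
    A zero denominator would be read as 1, whence the side condition in [ofQ_frac]. *)
Definition frac (a : int) (b : nat) : Q :=
  QArith_base.Qmake (Z_of_int a) (BinPos.Pos.of_nat b).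

Definition Qadd c d := Qreduction.Qred (QArith_base.Qplus c d).
Definition Qmul c d := Qreduction.Qred (QArith_base.Qmult c d).
Arguments Qadd : simpl never.
Arguments Qmul : simpl never.

(** * Interpretation of rational coefficients in a field *)

Section Coefficients.
Variable R : numFieldType.

Definition ofQ (c : Q) : R :=
  (int_of_Z (Qnum c))%:~R / (int_of_Z (BinInt.Z.pos (Qden c)))%:~R.

Lemma Qden_neq0 d : (int_of_Z (BinInt.Z.pos d))%:~R != 0 :> R.
Proof.
rewrite intr_eq0; apply/eqP => d0; have := int_of_ZK (BinInt.Z.pos d).
by rewrite d0.
Qed.

Let ofZD a b : (int_of_Z (BinInt.Z.add a b))%:~R =
  (int_of_Z a)%:~R + (int_of_Z b)%:~R :> R.
Proof. by rewrite [int_of_Z _](rmorphD int_of_Z a b) rmorphD. Qed.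

Let ofZM a b : (int_of_Z (BinInt.Z.mul a b))%:~R =
  (int_of_Z a)%:~R * (int_of_Z b)%:~R :> R.
Proof. by rewrite [int_of_Z _](rmorphM int_of_Z a b) rmorphM. Qed.

Lemma ofQ_eq c d : QArith_base.Qeq c d -> ofQ c = ofQ d.
Proof.
rewrite /QArith_base.Qeq /ofQ => cd; apply/eqP.
by rewrite eqr_div ?Qden_neq0 // -!ofZM cd.
Qed.

Lemma ofQ_red c : ofQ (Qreduction.Qred c) = ofQ c.
Proof. exact/ofQ_eq/Qreduction.Qred_correct. Qed.

Lemma ofQD c d : ofQ (Qadd c d) = ofQ c + ofQ d.
Proof. by rewrite ofQ_red /ofQ addf_div ?Qden_neq0 // -!ofZM -ofZD. Qed.

Lemma ofQM c d : ofQ (Qmul c d) = ofQ c * ofQ d.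
Proof. by rewrite ofQ_red /ofQ mulf_div -!ofZM. Qed.

Lemma ofQ0 d : ofQ (QArith_base.Qmake BinNums.Z0 d) = 0.
Proof. by rewrite /ofQ mul0r. Qed.

Lemma ofQ_frac a b : (0 < b)%N -> ofQ (frac a b) = a%:~R / b%:R.
Proof.
case: b => // b _; rewrite /ofQ /frac Z_of_intK.
by rewrite -[b.+1%:R]/(b.+1%:~R) -{2}(@Pnat.Nat2Pos.id b.+1).
Qed.

Lemma ofQ1 : ofQ (frac 1 1) = 1.
Proof. by rewrite ofQ_frac // divr1. Qed.

Lemma ofQN1 : ofQ (frac (-1) 1) = -1.
Proof. by rewrite ofQ_frac // divr1. Qed.

End Coefficients.

(* [Jet k s] is an iterated derivative of the k-th unknown function, along the
   coordinates listed in s, the last one first.  The words s are not sorted: the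
   computation below never needs the symmetry of second derivatives.  [Inv0] is
   the inverse of coordinate 0. *)
Inductive atom := Coord of nat | Inv0 | Jet of nat & seq nat.

(** One code serves twice: it gives atoms a decidable equality and, compared lexicographically, the
    order in which monomials are sorted. *)
Definition atom_code a : seq nat :=
  match a with Coord i => [:: 0%N; i] | Inv0 => [:: 0%N] | Jet k s => k.+1 :: s end.

Definition code_atom s : option atom :=
  match s with
  | [:: 0%N; i] => Some (Coord i) | [:: 0%N] => Some Inv0
  | k.+1 :: s => Some (Jet k s) | _ => None
  end.

Lemma atom_codeK : pcancel atom_code code_atom.
Proof. by case. Qed.

HB.instance Definition _ := Equality.copy atom (pcan_type atom_codeK).

Fixpoint lexle (s t : seq nat) : bool :=
  match s, t with
  | [::], _ => true
  | _, [::] => false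
  | i :: s', j :: t' => (i < j)%N || ((i == j) && lexle s' t')
  end.

Definition cancelling a b : bool :=
  match a, b with Coord 0, Inv0 | Inv0, Coord 0 => true | _, _ => false end.

(* [Inv0] and [Coord 0] are the two least atoms, hence adjacent, so that a
   sorted monomial is reduced by looking at neighbours only. *)
Fixpoint minsert a (m : seq atom) : seq atom :=
  if m is b :: m' then
    if cancelling a b then m'
    else if lexle (atom_code a) (atom_code b) then a :: m else b :: minsert a m'
  else [:: a].

Definition dpoly := seq (Q * seq atom).

(** Terms that cancel must disappear, since an identity is later recognised by its difference being
    the empty list. *)
Definition pcons (c : Q) (m : seq atom) (p : dpoly) : dpoly :=
  if Qnum c is BinNums.Z0 then p else (c, m) :: p.

Fixpoint padd1 (c : Q) (m : seq atom) (p : dpoly) : dpoly :=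
  if p is (d, m') :: p' then
    if m == m' then pcons (Qadd c d) m p' else (d, m') :: padd1 c m p'
  else [:: (c, m)].

Definition padd (p q : dpoly) : dpoly :=
  foldr (fun cm r => padd1 cm.1 cm.2 r) q p.

Definition psum (s : seq dpoly) : dpoly := foldr padd [::] s.

Definition pmul (p q : dpoly) : dpoly :=
  psum [seq foldr (fun dm r =>
      padd1 (Qmul cm.1 dm.1) (foldr minsert dm.2 cm.2) r)
    [::] q | cm <- p].

Definition patom a : dpoly := [:: (frac 1 1, [:: a])].

Definition pcst (c : Q) : dpoly := [:: (c, [::])].

Section Derivation.
Variable dep : nat -> seq nat.

Definition pderiv_atom i a : dpoly :=
  match a with
  | Coord j => if i == j then pcst (frac 1 1) else [::]
  | Inv0 => if i == 0%N then [:: (frac (-1) 1, [:: Inv0; Inv0])] else [::]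
  | Jet k s => if i \in dep k then patom (Jet k (i :: s)) else [::]
  end.

Fixpoint pderiv_mono i (m : seq atom) : dpoly :=
  if m is a :: m' then
    padd (pmul (pderiv_atom i a) [:: (frac 1 1, m')])
         (pmul (patom a) (pderiv_mono i m'))
  else [::].

Definition pderiv i (p : dpoly) : dpoly :=
  psum [seq pmul (pcst cm.1) (pderiv_mono i cm.2) | cm <- p].

End Derivation.

(** Differentiability depends only on the germ: the first-order expansion of [g] at [x] is also one
    of [f], and uniqueness identifies its linear part with the differential of [f]. *)
Lemma near_eq_differentiable (R : numFieldType) (V W : normedModType R)
    (f g : V -> W) (x : V) :
  {near x, f =1 g} -> differentiable g x -> differentiable f x.
Proof.
move=> fg dg; have [dgc dgE] := (diff_locallyP _ _).1 dg.
have dfE : f \o shift x = cst (f x) + 'd g x +o_ 0 id.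
  rewrite (nbhs_singleton fg); apply/eqaddoP => e e0.
  have h1 := (eqaddoP _ _ _ _).1 dgE e e0.
  have h2 : \forall y \near 0, f (y + x) = g (y + x).
    by move: fg; rewrite (near_shift 0 x) /=; apply: filterS => y; rewrite subr0.
  apply: filterS2 h1 h2 => y /= h1 h2; move: h1.
  rewrite (_ : (f \o _ - _) y = (g \o +%R^~ x - (cst (g x) + 'd g x)) y) //.
  exact: (congr1 (fun z => z - _) h2).
have dE := diff_unique dgc dfE.
apply/diff_locallyP; rewrite dE; exact: (conj dgc dfE).
Qed.

(** * Evaluation of differential polynomials and correctness of formal differentiation *)

Section Evaluation.
Variables (R : realType) (n : nat) (F : nat -> 'rV[R]_n.+1 -> R).
Implicit Types (X : 'rV[R]_n.+1) (p q : dpoly) (m : seq atom).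

(** Out of range, [inord i] would be coordinate 0; the default 0 makes the atom constant instead, in
    agreement with its formal derivatives in the directions below [n.+1]. *)
Definition atom_eval a X : R :=
  match a with
  | Coord i => if (i < n.+1)%N then X 0 (inord i) else 0
  | Inv0 => (X 0 ord0)^-1
  | Jet k s => foldr (@partial R n.+1) (F k) (map inord s) X
  end.

Definition mono_eval m X : R := \prod_(a <- m) atom_eval a X.
Definition peval p X : R := \sum_(cm <- p) ofQ R cm.1 * mono_eval cm.2 X.

Lemma mono_eval_nil X : mono_eval [::] X = 1.
Proof. by rewrite /mono_eval big_nil. Qed.

Lemma mono_eval_cons a m X : mono_eval (a :: m) X = atom_eval a X * mono_eval m X.
Proof. by rewrite /mono_eval big_cons. Qed.

Lemma peval_nil X : peval [::] X = 0.
Proof. by rewrite /peval big_nil. Qed.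

Lemma peval_cons c m p X : peval ((c, m) :: p) X = ofQ R c * mono_eval m X + peval p X.
Proof. by rewrite /peval big_cons. Qed.

Lemma peval_pcons c m p X : peval (pcons c m p) X = ofQ R c * mono_eval m X + peval p X.
Proof.
rewrite /pcons; case: c => [[|e|e] d] /=; rewrite ?peval_cons //.
by rewrite ofQ0 mul0r add0r.
Qed.

Lemma peval_padd1 c m p X : peval (padd1 c m p) X = ofQ R c * mono_eval m X + peval p X.
Proof.
elim: p => [|[d m'] p IH] /=; first by rewrite peval_cons.
case: eqVneq => [<-|_]; last by rewrite !peval_cons IH; ring.
by rewrite peval_pcons ofQD peval_cons; ring.
Qed.

Lemma peval_padd p q X : peval (padd p q) X = peval p X + peval q X.
Proof.
elim: p => [|[c m] p IH] /=; first by rewrite peval_nil add0r.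
by rewrite peval_padd1 IH peval_cons addrA.
Qed.

Lemma peval_psum s X : peval (psum s) X = \sum_(p <- s) peval p X.
Proof.
by elim: s => [|p s IH]; rewrite ?big_nil ?peval_nil // big_cons -IH -peval_padd.
Qed.

Lemma peval_patom a X : peval (patom a) X = atom_eval a X.
Proof. by rewrite peval_cons peval_nil mono_eval_cons mono_eval_nil ofQ1; ring. Qed.

Lemma peval_pcst c X : peval (pcst c) X = ofQ R c.
Proof. by rewrite peval_cons peval_nil mono_eval_nil mulr1 addr0. Qed.

Variables (dom : set 'rV[R]_n.+1) (dep : nat -> seq nat).
Hypothesis (dom_open : open dom) (dom_neq0 : forall X, dom X -> X 0 ord0 != 0).
Hypothesis F_smooth : forall k, smooth_on dom (F k).
(** Required for every iterated derivative, since [pderiv_atom] discards a jet in a direction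
    outside [dep k] whatever its word. *)
Hypothesis F_dep : forall k s i X, i \notin dep k -> (i < n.+1)%N -> dom X ->
  partial (inord i) (foldr (@partial R n.+1) (F k) s) X = 0.

(** Cancelling [Coord 0] against [Inv0] is legitimate because coordinate 0 does not vanish on
    [dom]. *)
Lemma mono_eval_minsert a m X : dom X ->
  mono_eval (minsert a m) X = atom_eval a X * mono_eval m X.
Proof.
move=> /dom_neq0 X0; elim: m => [|b m IH] /=; first by rewrite mono_eval_cons.
have inord0 : inord 0 = ord0 :> 'I_n.+1 by apply/val_inj; rewrite /= inordK.
case: ifPn => [|_].
  rewrite mono_eval_cons mulrA.
  case: a b {IH} => [[|i]||k s] [[|j]||l t] //= _; rewrite inord0.
    by rewrite mulfV // mul1r.
  by rewrite mulVf // mul1r.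
by case: ifP => _; rewrite !mono_eval_cons // IH; ring.
Qed.

Lemma peval_pmul p q X : dom X -> peval (pmul p q) X = peval p X * peval q X.
Proof.
move=> dX; rewrite /pmul peval_psum big_map [peval p X]/peval mulr_suml.
apply: eq_bigr => -[c m] _ /=.
elim: q => [|[d m'] q IH] /=; first by rewrite peval_nil mulr0.
rewrite peval_padd1 IH peval_cons ofQM mulrDr; congr (_ + _).
suff -> : mono_eval (foldr minsert m' m) X = mono_eval m X * mono_eval m' X by ring.
elim: m {IH} => [|a m IH]; first by rewrite mono_eval_nil mul1r.
by rewrite /= mono_eval_minsert // IH mono_eval_cons mulrA.
Qed.

(* [is_derive] in a coordinate direction says nothing in the other directions,
   hence the separate differentiability. *)
Definition has_partial i (f g : 'rV[R]_n.+1 -> R) X :=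
  differentiable f X /\ partial (inord i) f X = g X.

Lemma has_partialM i f g f' g' X : has_partial i f f' X -> has_partial i g g' X ->
  has_partial i (f \* g) (fun X => f' X * g X + f X * g' X) X.
Proof.
move=> [df pf] [dg pg]; split; first exact: differentiableM.
rewrite /partial deriveM; try exact: diff_derivable.
by rewrite -!/(partial _ _ _) pf pg /GRing.scale /=; ring.
Qed.

Lemma has_partialD i f g f' g' X : has_partial i f f' X -> has_partial i g g' X ->
  has_partial i (f \+ g) (f' \+ g') X.
Proof.
move=> [df pf] [dg pg]; split; first exact: differentiableD.
rewrite /partial deriveD; try exact: diff_derivable.
by rewrite -!/(partial _ _ _) pf pg.
Qed.

Lemma has_partial_cst i c X : has_partial i (cst c) (cst 0) X.
Proof. by split; [exact: differentiable_cst | rewrite /partial derive_cst]. Qed.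

Lemma has_partial_coord i j X : (i < n.+1)%N -> (j < n.+1)%N ->
  has_partial i (fun Y => Y 0 (inord j)) (cst (i == j)%:R) X.
Proof.
move=> ilt jlt; split; first exact: differentiable_coord.
(* The derivative of the identity along a basis vector is that vector; its entry j is the partial
   derivative sought. *)
have := @derive_mx R _ 1 n.+1 id X (delta_mx 0 (inord i)) (@derivable_id _ _ _ _).
rewrite derive_id => /matrixP/(_ 0 (inord j)).
rewrite !mxE /= /partial => <-.
by rewrite -val_eqE /= !inordK // eq_sym.
Qed.

Lemma has_partial_atom i a X : (i < n.+1)%N -> dom X ->
  has_partial i (atom_eval a) (peval (pderiv_atom dep i a)) X.
Proof.
move=> ilt dX; case: a => [j||k s] /=.
- rewrite /atom_eval; case: ltnP => [jlt|jge].
    have [dc pc] := has_partial_coord X ilt jlt; split=> //; rewrite pc.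
    by case: eqVneq => _ /=; rewrite ?peval_pcst ?ofQ1 ?peval_nil.
  have [dc pc] := has_partial_cst i 0 X; split=> //; rewrite pc.
  case: eqVneq => [ij|_]; last by rewrite peval_nil.
  by move: jge; rewrite -ij leqNgt ilt.
- have X0 := dom_neq0 dX.
  have inord0 : inord 0 = ord0 :> 'I_n.+1 by apply/val_inj; rewrite /= inordK.
  have := @has_partial_coord i 0 X ilt isT; rewrite inord0 => -[dc pc].
  split; first exact: differentiableV.
  rewrite /partial deriveV //; last exact: diff_derivable.
  rewrite -/(partial _ _ _) pc /= /GRing.scale /=.
  case: eqVneq => _; last by rewrite peval_nil mulr0.
  by rewrite peval_cons peval_nil !mono_eval_cons mono_eval_nil ofQN1 /=; field.
- split; first by have := F_smooth k (map inord s) dX.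
  case: ifPn => [_|idep]; first by rewrite peval_patom.
  by rewrite peval_nil; exact: F_dep.
Qed.

Lemma has_partial_mono i m X : (i < n.+1)%N -> dom X ->
  has_partial i (mono_eval m) (peval (pderiv_mono dep i m)) X.
Proof.
move=> ilt dX; elim: m => [|a m IH].
  rewrite (_ : mono_eval [::] = cst 1); last by apply/funext => Y; rewrite mono_eval_nil.
  have [dc pc] := has_partial_cst i 1 X; split=> //; rewrite pc.
  by rewrite peval_nil.
rewrite (_ : mono_eval (a :: m) = atom_eval a \* mono_eval m); last first.
  by apply/funext => Y; rewrite mono_eval_cons.
have [dM pM] := has_partialM (has_partial_atom a ilt dX) IH; split=> //.
rewrite pM /= peval_padd !peval_pmul // peval_patom.
by rewrite peval_cons peval_nil ofQ1 mul1r addr0.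
Qed.

Lemma has_partial_peval i p X : (i < n.+1)%N -> dom X ->
  has_partial i (peval p) (peval (pderiv dep i p)) X.
Proof.
move=> ilt dX; elim: p => [|[c m] p IH].
  rewrite (_ : peval [::] = cst 0); last by apply/funext => Y; rewrite peval_nil.
  have [dc pc] := has_partial_cst i 0 X; exact: (conj dc pc).
rewrite (_ : peval ((c, m) :: p) = (cst (ofQ R c) \* mono_eval m) \+ peval p); last first.
  by apply/funext => Y; rewrite peval_cons.
have [dM pM] := has_partialD
  (has_partialM (has_partial_cst i (ofQ R c) X) (has_partial_mono m ilt dX)) IH.
split=> //; rewrite pM /= mul0r add0r.
rewrite [pderiv _ _ (_ :: _)]/(padd _ _).
by rewrite peval_padd peval_pmul // peval_pcst.
Qed.

Definition represents f p := forall X, dom X -> f X = peval p X.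

(** As [dom] is open, [f] and the evaluation of [p] agree near each of its points, hence so do their
    partial derivatives there. *)
Lemma represents_partial i f p : (i < n.+1)%N ->
  represents f p -> represents (partial (inord i) f) (pderiv dep i p).
Proof.
move=> ilt fp X dX; have [_ <-] := has_partial_peval p ilt dX.
apply: near_eq_derive; apply: filterS (open_nbhs_nbhs (conj dom_open dX)) => Y.
exact: fp.
Qed.

Lemma represents_smooth f p : represents f p -> smooth_on dom f.
Proof.
move=> fp s X dX; have [q fq] : exists q, represents (foldr (@partial R n.+1) f s) q.
  elim: s => [|i s [q IH]]; first by exists p.
  exists (pderiv dep i q); have := represents_partial (ltn_ord i) IH.
  by rewrite inord_val.
(* Direction 0 is an arbitrary choice: only the differentiability of the polynomial is kept. *)
have [dq _] := has_partial_peval q (ltn0Sn n) dX.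
apply: near_eq_differentiable dq; apply: filterS (open_nbhs_nbhs (conj dom_open dX)) => Y.
by move=> /fq.
Qed.

End Evaluation.

(** * Symbolic curvature *)

Arguments padd : simpl never.
Arguments pmul : simpl never.
Arguments psum : simpl never.
Arguments patom : simpl never.
Arguments pcst : simpl never.
Arguments pderiv : simpl never.
Arguments peval : simpl never.

Declare Scope dpoly_scope.
Delimit Scope dpoly_scope with dP.
Bind Scope dpoly_scope with dpoly.
Notation "p + q" := (padd p q) : dpoly_scope.
Notation "p * q" := (pmul p q) : dpoly_scope.
Notation "- p" := (pmul (pcst (frac (-1) 1)) p) : dpoly_scope.
Notation "p - q" := (padd p (- q)%dP) : dpoly_scope.

(* The tables make evaluation share the entries of [f]. *)
Definition memo2 n (f : nat -> nat -> dpoly) : nat -> nat -> dpoly :=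
  let T := [seq [seq f i j | j <- iota 0 n] | i <- iota 0 n] in
  fun i j => nth [::] (nth [::] T i) j.

Definition memo3 n (f : nat -> nat -> nat -> dpoly) : nat -> nat -> nat -> dpoly :=
  let T := [seq [seq [seq f k i j | j <- iota 0 n] | i <- iota 0 n] | k <- iota 0 n] in
  fun k i j => nth [::] (nth [::] (nth [::] T k) i) j.

Lemma memo2E n f i j : (i < n)%N -> (j < n)%N -> memo2 n f i j = f i j.
Proof. by move=> i_n j_n; rewrite /memo2 !(nth_map 0%N) ?size_iota // !nth_iota. Qed.

Lemma memo3E n f k i j :
  (k < n)%N -> (i < n)%N -> (j < n)%N -> memo3 n f k i j = f k i j.
Proof.
by move=> k_n i_n j_n; rewrite /memo3 !(nth_map 0%N) ?size_iota // !nth_iota.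
Qed.

Section SymbolicCurvature.
Variable dep : nat -> seq nat.
Variable n : nat.
Local Notation pderiv := (pderiv dep).

Definition christoffelP (g gi : nat -> nat -> dpoly) k i j : dpoly :=
  psum [seq pcst (frac 1 2) * gi k l * (pderiv i (g l j) + pderiv j (g l i) - pderiv l (g i j))
       | l <- iota 0 n]%dP.

Definition ricciP (Gam : nat -> nat -> nat -> dpoly) i j : dpoly :=
  (psum [seq pderiv k (Gam k i j) - pderiv j (Gam k i k) | k <- iota 0 n]
   + psum [seq psum [seq Gam k k l * Gam l i j - Gam k j l * Gam l i k
                    | l <- iota 0 n] | k <- iota 0 n])%dP.

End SymbolicCurvature.

(** * The symbolic Christoffel symbols and Ricci tensor evaluate to the analytic ones *)

Section Soundness.
Variables (R : realType) (n : nat) (F : nat -> 'rV[R]_n.+1 -> R).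
Variables (dom : set 'rV[R]_n.+1) (dep : nat -> seq nat).
Hypothesis (dom_open : open dom) (dom_neq0 : forall X, dom X -> X 0 ord0 != 0).
Hypothesis F_smooth : forall k, smooth_on dom (F k).
Hypothesis F_dep : forall k s i X, i \notin dep k -> (i < n.+1)%N -> dom X ->
  partial (inord i) (foldr (@partial R n.+1) (F k) s) X = 0.
Local Notation represents := (represents F dom).

Lemma represents_add f g p q : represents f p -> represents g q ->
  represents (f \+ g) (p + q)%dP.
Proof. by move=> fp gq X dX; rewrite peval_padd -fp // -gq. Qed.

Lemma represents_mul f g p q : represents f p -> represents g q ->
  represents (f \* g) (p * q)%dP.
Proof. by move=> fp gq X dX; rewrite (peval_pmul _ dom_neq0) // -fp // -gq. Qed.

Lemma represents_cst c : represents (cst (ofQ R c)) (pcst c).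
Proof. by move=> X dX; rewrite peval_pcst. Qed.

Lemma represents_opp f p : represents f p -> represents (\- f) (- p)%dP.
Proof.
move=> fp X dX; rewrite -(represents_mul (represents_cst _) fp) //=.
by rewrite ofQN1 mulN1r.
Qed.

Lemma represents_sum (f : 'I_n.+1 -> 'rV[R]_n.+1 -> R) (p : nat -> dpoly) :
  (forall i : 'I_n.+1, represents (f i) (p i)) ->
  represents (fun X => \sum_i f i X) (psum [seq p i | i <- iota 0 n.+1]).
Proof.
move=> fp X dX; rewrite peval_psum big_map -[iota 0 n.+1]/(index_iota 0 n.+1) big_mkord.
by apply: eq_bigr => i _; exact: fp.
Qed.

Lemma represents_ext f g p : (forall X, dom X -> f X = g X) ->
  represents g p -> represents f p.
Proof. by move=> fg gp X dX; rewrite fg // gp. Qed.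

Variables (G : 'rV[R]_n.+1 -> 'M[R]_n.+1) (g gi : nat -> nat -> dpoly).
Hypothesis represents_metric :
  forall i j : 'I_n.+1, represents (fun X => G X i j) (g i j).
Hypothesis represents_inverse :
  forall i j : 'I_n.+1, represents (fun X => invmx (G X) i j) (gi i j).

Let rep_partial (i : 'I_n.+1) f p :
  represents f p -> represents (partial i f) (pderiv dep i p).
Proof.
move=> fp; have := represents_partial dom_open dom_neq0 F_smooth F_dep (ltn_ord i) fp.
by rewrite inord_val.
Qed.

Lemma represents_christoffel k i j :
  represents (christoffel G k i j) (christoffelP dep n.+1 g gi k i j).
Proof.
apply: (@represents_sum (fun l X => invmx (G X) k l / 2 *
    (partial i (fun y => G y l j) X + partial j (fun y => G y l i) X
     - partial l (fun y => G y i j) X))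
   (fun l => pcst (frac 1 2) * gi k l *
     (pderiv dep i (g l j) + pderiv dep j (g l i) - pderiv dep l (g i j)))%dP).
move=> l; apply: (represents_ext _
 (represents_mul (represents_mul (represents_cst _) (represents_inverse k l))
   (represents_add
     (represents_add (rep_partial i (represents_metric l j))
       (rep_partial j (represents_metric l i)))
     (represents_opp (rep_partial l (represents_metric i j)))))).
by move=> X _ /=; rewrite ofQ_frac // div1r [X in X * _ = _]mulrC.
Qed.

Lemma represents_ricci i j : represents (fun X => ricci G X i j)
  (ricciP dep n.+1 (memo3 n.+1 (christoffelP dep n.+1 g gi)) i j).
Proof.
set Gam := memo3 _ _.
have Gm (k l m : 'I_n.+1) : represents (christoffel G k l m) (Gam k l m).
  by rewrite /Gam memo3E //; exact: represents_christoffel.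
apply: (represents_ext _ (represents_add
  (represents_sum (fun k =>
     represents_add (rep_partial k (Gm k i j)) (represents_opp (rep_partial j (Gm k i k)))))
  (represents_sum (fun k => represents_sum (fun l =>
     represents_add (represents_mul (Gm k k l) (Gm l i j))
       (represents_opp (represents_mul (Gm k j l) (Gm l i k)))))))).
by move=> X dX; rewrite mxE.
Qed.

End Soundness.

(** * The ambient metric as a matrix of differential polynomials, and its Ricci tensor *)

Section SymbolicMetric.
Local Open Scope nat_scope.
Local Open Scope dpoly_scope.

(* Coordinates 0, ..., 6 are t, x, y, z, p, q, rho; jets 0, ..., 4 are those of
   f, h, A, B, C. *)
Definition dep (k : nat) : seq nat :=
  nth [::] [:: [:: 1; 2; 4]; [:: 1; 2]; [:: 1; 2; 4; 6]; [:: 1; 2; 4; 6];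
              [:: 1; 2; 4; 6]]%N k.

Local Notation c a b := (pcst (frac a%Z b%N)).
Local Notation X i := (patom (Coord i%N)).
Local Notation J k s := (patom (Jet k%N s%N)).

(** The seven components in the order t, x, y, z, p, q, rho. The vector fields of the dual frame are
    stored in the same way. *)
Definition form := seq dpoly.
Definition combine (s : seq (dpoly * form)) : form :=
  mkseq (fun i => psum [seq pw.1 * nth [::] pw.2 i | pw <- s]) 7.

Definition basisP k : form := mkseq (fun i => if (i == k)%N then c 1 1 else [::]) 7.

Definition theta1P : form := combine [:: (c 1 1, basisP 2); (- X 4, basisP 1)].

(* theta^3 / (2 sqrt 2) *)
Definition sigmaP : form := combine [:: (c 1 1, basisP 4); (- X 5, basisP 1)].
(** Since $\theta^3=2\sqrt2\,\sigma$, the term $\frac{\sqrt2}2q\,\theta^3$ is $2q\,\sigma$. Likewise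
    $\theta^3$ enters $\theta^5$ as $2h\,\sigma$ and the metric as $8\sigma^2$, so every coefficient
    is rational. *)
Definition theta2P : form :=
  combine [:: (c 1 1, basisP 3);
    (- (X 5 * X 5 + J 0 [::] + J 1 [::] * X 3), basisP 1);
    (- (c 2 1 * X 5), sigmaP)].
Definition theta4P : form := combine [:: (c 3 1, basisP 1)].
Definition kappaP : dpoly :=
  c 1 10 * (c 9 1 * J 0 [:: 4; 4] + c 4 1 * J 1 [::] * J 1 [::]
   - c 6 1 * (X 4 * J 1 [:: 2] + J 1 [:: 1])).
Definition theta5P : form :=
  combine [:: (c 2 1 * J 1 [::], sigmaP); (c (-6) 1, basisP 5);
    (c 3 1 * (c 2 1 * J 1 [::] * X 5 + J 0 [:: 4]), basisP 1); (kappaP, theta1P)].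

Definition sprodP (a b : form) i j :=
  c 1 2 * (nth [::] a i * nth [::] b j + nth [::] b i * nth [::] a j).

Definition metricP i j : dpoly :=
  c 2 1 * sprodP (basisP 0) (combine [:: (X 6, basisP 0); (X 0, basisP 6)]) i j
  + X 0 * X 0 *
    (c 2 1 * sprodP theta1P theta5P i j - c 2 1 * sprodP theta2P theta4P i j
     + c 8 1 * sprodP sigmaP sigmaP i j
     + J 2 [::] * sprodP theta1P theta1P i j
     + c 2 1 * J 3 [::] * sprodP theta1P theta4P i j
     + J 4 [::] * sprodP theta4P theta4P i j).

(* The frame dual to theta1, theta2, theta3 / (2 sqrt 2), theta4, theta5. *)
Definition e1P : form := combine [:: (c 1 1, basisP 2); (c 1 6 * kappaP, basisP 5)].
Definition e2P : form := basisP 3.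
Definition e3P : form :=
  combine [:: (c 1 1, basisP 4); (c 2 1 * X 5, basisP 3); (c 1 3 * J 1 [::], basisP 5)].
Definition e4P : form :=
  combine [:: (c 1 3, basisP 1); (c 1 3 * X 4, basisP 2);
    (c 1 3 * (X 5 * X 5 + J 0 [::] + J 1 [::] * X 3), basisP 3);
    (c 1 3 * X 5, basisP 4);
    (c 1 6 * (c 2 1 * J 1 [::] * X 5 + J 0 [:: 4]), basisP 5)].
Definition e5P : form := combine [:: (c (-1) 6, basisP 5)].

(** The (t, rho) block has inverse
    $\frac2t\partial_t\partial_\varrho-\frac{2\varrho}{t^2}\partial_\varrho^2$. As
    $\theta^1,\theta^4$ span a null plane of the dual metric of $g_{\mathcal D_{f,h}}$, the
    correction by A, B, C is inverted exactly by terms linear in them, supported on [e2P] and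
    [e5P]. *)
Definition inverseP i j : dpoly :=
  c 2 1 * patom Inv0 * sprodP (basisP 0) (basisP 6) i j
  + patom Inv0 * patom Inv0 *
    (c 2 1 * sprodP e1P e5P i j - c 2 1 * sprodP e2P e4P i j
     + c 1 8 * sprodP e3P e3P i j
     - J 2 [::] * sprodP e5P e5P i j + c 2 1 * J 3 [::] * sprodP e2P e5P i j
     - J 4 [::] * sprodP e2P e2P i j
     - c 2 1 * X 6 * sprodP (basisP 6) (basisP 6) i j).

(** The operator L of the PDE system, applied to unknown k; coordinates 4 and 6 are p and rho. *)
Definition boxP k :=
  c 2 1 * X 6 * J k [:: 6; 6] - c 3 1 * J k [:: 6] - c 1 8 * J k [:: 4; 4].

Definition residualA := boxP 2 - c 9 40 * J 0 [:: 4; 4; 4; 4].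
Definition residualB :=
  boxP 3 - (c (-1) 36 * J 2 [:: 4] + c 3 40 * J 0 [:: 4; 4; 4] + c 9 20 * J 1 [:: 2]).
Definition residualC :=
  boxP 4 - (c (-1) 18 * J 3 [:: 4] + c 1 324 * J 2 [::] + c 1 30 * J 0 [:: 4; 4]
            - c 2 15 * J 1 [::] * J 1 [::] + c 1 5 * (X 4 * J 1 [:: 2] + J 1 [:: 1])).

Definition residualP i j :=
  c 1 2 * (residualA * sprodP theta1P theta1P i j
           + c 2 1 * residualB * sprodP theta1P theta4P i j
           + residualC * sprodP theta4P theta4P i j).

(** A sufficient test only: no canonical form is claimed, but an empty difference evaluates to
    zero. *)
Definition equalP n (f g : nat -> nat -> dpoly) : bool :=
  all (fun i => all (fun j => nilp (f i j - g i j)) (iota 0 n)) (iota 0 n).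

Lemma metricP_sym : equalP 7 metricP (fun i j => metricP j i).
Proof. by vm_compute. Qed.

(** The inverse matrix was written down from the dual frame, so a single multiplication certifies
    it. *)
Lemma metricPK : equalP 7
  (fun i j => psum [seq metricP i k * inverseP k j | k <- iota 0 7])
  (fun i j => if (i == j)%N then c 1 1 else [::]).
Proof. by vm_compute. Qed.

Definition Gamma := memo3 7 (christoffelP dep 7 (memo2 7 metricP) (memo2 7 inverseP)).

(** The heart of the computation: for all 49 components, Ricci minus the expected combination of
    residuals reduces to the empty polynomial. *)
Lemma ricciP_residual : equalP 7 (ricciP dep 7 Gamma) residualP.
Proof. by vm_compute. Qed.

End SymbolicMetric.

(** * Functions of some of the coordinates *)

Lemma foldr_partial_cst0 (R : realType) m (r : seq 'I_m) :
  foldr (@partial R m) (cst 0 : 'rV[R]_m -> R) r = cst 0.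
Proof. by elim: r => //= i r ->; apply/funext => X; rewrite /partial derive_cst. Qed.

Lemma smooth_cst (R : realType) n (D : set 'rV[R]_n) (c : R) : smooth_on D (cst c).
Proof.
move=> s x _; suff [d ->] : exists d, foldr (@partial R n) (cst c) s = cst d.
  exact: differentiable_cst.
elim: s => [|i s [d IH]]; first by exists c.
by exists 0; rewrite /= IH; apply/funext => y; rewrite /partial derive_cst.
Qed.

Section Pullback.
Variables (R : realType) (n : nat) (s : seq nat).
Hypotheses (s_uniq : uniq s) (s_lt : {in s, forall i, (i < n.+1)%N}).
Local Notation k := (size s).
Implicit Types (g : 'rV[R]_k -> R) (X : 'rV[R]_n.+1).

(** A coordinate projection; composing with it turns f, h, A, B, C into functions on the ambient
    space. *)
Definition select (X : 'rV[R]_n.+1) : 'rV[R]_k := \row_(j < k) X 0 (inord (nth 0%N s j)).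

Lemma differentiable_select X : differentiable select X.
Proof.
rewrite (_ : select = \sum_(j < k)
    (fun Y : 'rV[R]_n.+1 => Y 0 (inord (nth 0%N s j)) *: delta_mx 0 j)).
  apply: differentiable_sum => j.
  by apply: differentiableZl; exact: differentiable_coord.
apply/funext => Y; rewrite fct_sumE [LHS]row_sum_delta.
by apply: eq_bigr => j _; rewrite mxE.
Qed.

(** Chain rule along a linear map: both sides are limits of the same difference quotient. *)
Lemma partial_select g i X :
  partial i (g \o select) X = 'D_(select (delta_mx 0 i)) g (select X).
Proof.
rewrite /partial /derive.
have -> : (fun h : R => h^-1 *: ((g \o select \o shift X) (h *: delta_mx 0 i) - (g \o select) X))
  = (fun h => h^-1 *: ((g \o shift (select X)) (h *: select (delta_mx 0 i)) - g (select X))).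
  apply/funext => h /=.
  by congr (_ *: (g _ - _)); apply/rowP => j; rewrite !mxE.
by [].
Qed.

Lemma partial_select_in g (j : 'I_k) :
  partial (inord (nth 0%N s j)) (g \o select) = partial j g \o select.
Proof.
apply/funext => X; rewrite partial_select /=; congr ('D_ _ _ _).
apply/rowP => l; rewrite !mxE /= -!val_eqE /=.
have lt (m : 'I_k) : ((nth 0%N s m) < n.+1)%N by apply: s_lt; exact: mem_nth.
by rewrite !inordK // nth_uniq.
Qed.

Lemma partial_select_notin g i : i \notin s -> (i < n.+1)%N ->
  partial (inord i) (g \o select) = cst 0.
Proof.
move=> si i_n; apply/funext => X; rewrite partial_select.
rewrite (_ : select (delta_mx _ _) = 0) ?derive0 //.
apply/rowP => l; rewrite !mxE /= -val_eqE /=.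
have sl : (nth 0%N s l) \in s by exact: mem_nth.
rewrite !inordK //; last exact: s_lt.
by case: eqVneq => // il; rewrite -il sl in si.
Qed.

(** A direction outside [s] kills the derivative for good; otherwise every direction translates to
    its position in [s]. *)
Lemma foldr_partial_select g (r : seq 'I_n.+1) :
  foldr (@partial R n.+1) (g \o select) r = cst 0 \/
  exists r', foldr (@partial R n.+1) (g \o select) r = foldr (@partial R k) g r' \o select.
Proof.
elim: r => [|i r [IH|[r' IH]]] /=; first by right; exists [::].
  by left; rewrite IH; apply/funext => X; rewrite /partial derive_cst.
rewrite IH; case: (boolP (val i \in s)) => [|si]; last first.
  by left; rewrite -[i]inord_val partial_select_notin.
move=> /[dup] si; rewrite -index_mem => lt_i.
right; exists (Ordinal lt_i :: r').
have nth_i : inord (nth 0%N s (Ordinal lt_i)) = i :> 'I_n.+1.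
  by rewrite [nth _ _ _](nth_index _ si) inord_val.
by rewrite -[X in partial X]nth_i partial_select_in.
Qed.

Lemma smooth_select g (dom : set 'rV[R]_n.+1) (E : set 'rV[R]_k) :
  smooth_on E g -> (forall X, dom X -> E (select X)) -> smooth_on dom (g \o select).
Proof.
move=> g_smooth dom_E r X dX.
have [->|[r' ->]] := foldr_partial_select g r; first exact: differentiable_cst.
apply: differentiable_comp; first exact: differentiable_select.
exact/g_smooth/dom_E.
Qed.

Lemma foldr_partial_select_notin g i r X : i \notin s -> (i < n.+1)%N ->
  partial (inord i) (foldr (@partial R n.+1) (g \o select) r) X = 0.
Proof.
move=> si i_n; have [->|[r' ->]] := foldr_partial_select g r.
  by rewrite /partial derive_cst.
by rewrite partial_select_notin.
Qed.

End Pullback.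

(** * The ambient metric in coordinates *)

Section AmbientCoordinates.
Variable R : realType.
Implicit Types (X : 'rV[R]_(1 + 5 + 1)).

Definition i_t : 'I_(1 + 5 + 1) := lshift 1 (lshift 5 ord0).
Definition i_x (j : 'I_5) : 'I_(1 + 5 + 1) := lshift 1 (rshift 1 j).
Definition i_rho : 'I_(1 + 5 + 1) := rshift (1 + 5) ord0.

(** Case analysis on an index along the block decomposition of the ambient coordinates. *)
Variant ambient_index : 'I_(1 + 5 + 1) -> Type :=
| AmbT : ambient_index i_t
| AmbX j : ambient_index (i_x j)
| AmbRho : ambient_index i_rho.

Lemma ambient_indexP i : ambient_index i.
Proof.
case: (fintype.split_ordP i) => j ->; last by rewrite [j]ord1; constructor.
case: (fintype.split_ordP j) => l ->; last by constructor.
by rewrite [l]ord1; constructor.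
Qed.

Lemma amb_tE X : amb_t X = X 0 (inord 0).
Proof. by rewrite /amb_t !mxE; congr (X _ _); apply/val_inj; rewrite /= inordK. Qed.

Lemma amb_xE X j : amb_x X 0 j = X 0 (inord j.+1).
Proof.
rewrite !mxE; congr (X _ _); apply/val_inj; rewrite /= inordK //.
by rewrite ltnS ltnW // ltnS ltn_ord.
Qed.

Lemma amb_rhoE X : amb_rho X = X 0 (inord 6).
Proof. by rewrite /amb_rho !mxE; congr (X _ _); apply/val_inj; rewrite /= inordK. Qed.

Lemma xy_select X : xy (amb_x X) = select [:: 1; 2]%N X.
Proof. by apply/rowP => -[[|[|j]] jlt] //; rewrite [LHS]mxE [RHS]mxE /= amb_xE. Qed.

Lemma xyp_select X : xyp (amb_x X) = select [:: 1; 2; 4]%N X.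
Proof. by apply/rowP => -[[|[|[|j]]] jlt] //; rewrite [LHS]mxE [RHS]mxE /= amb_xE. Qed.

Lemma xypr_select X : xypr (amb_x X, amb_rho X) = select [:: 1; 2; 4; 6]%N X.
Proof.
by apply/rowP => -[[|[|[|[|j]]]] jlt] //; rewrite [LHS]mxE [RHS]mxE /= ?amb_xE ?amb_rhoE.
Qed.

Lemma open_ambient_dom (U : set 'rV[R]_5) W : ambient_base U W ->
  open (ambient_dom W).
Proof.
move=> [_ openW _ _].
have -> : ambient_dom W = (@amb_t R 5) @^-1` [set x | 0 < x] `&`
    (fun X => (amb_x X, amb_rho X)) @^-1` W by [].
have cx : continuous (@amb_x R 5).
  by move=> X; apply: continuous_comp; [exact: continuous_lsubmx | exact: continuous_rsubmx].
have ct : continuous (@amb_t R 5).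
  rewrite (_ : @amb_t R 5 = fun X => X 0 (inord 0)); last by apply/funext => X; rewrite amb_tE.
  exact: coord_continuous.
have cr : continuous (@amb_rho R 5).
  rewrite (_ : @amb_rho R 5 = fun X => X 0 (inord 6)); last by apply/funext => X; rewrite amb_rhoE.
  exact: coord_continuous.
apply: openI.
  by apply: open_comp => [X _|]; [exact: ct | exact: open_gt].
apply: open_comp => // X _.
exact: (cvg_pair (cx X) (cr X)).
Qed.

End AmbientCoordinates.

(** * Pull-back to the ambient space, and algebra of the co-frame *)

Section Forms.
Variable R : realType.
Implicit Types (a b : 'rV[R]_5) (M N : 'M[R]_5).

(** Right multiplication by this matrix pulls 1-forms back from R^5 to the ambient space, in
    accordance with [pull] for bilinear forms. *)
Definition inclusion : 'M[R]_(5, 1 + 5 + 1) := row_mx (row_mx 0 1%:M) 0.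

Definition pull M : 'M[R]_(1 + 5 + 1) := inclusion^T *m M *m inclusion.

Lemma amb_pullE M : amb_pull M = pull M.
Proof.
rewrite /amb_pull /pull /inclusion !tr_row_mx !trmx0 trmx1.
rewrite 2![col_mx _ _ *m M]mul_col_mx !mul0mx mul1mx.
by rewrite !mul_col_row !mulmx0 !mul0mx mulmx1.
Qed.

Lemma inclusionK : inclusion *m inclusion^T = 1%:M.
Proof.
by rewrite /inclusion !tr_row_mx !mul_row_col !trmx0 trmx1 !mulmx0 add0r addr0 mulmx1.
Qed.

Lemma pull_inj M : pull M = 0 -> M = 0.
Proof.
move=> M0; have : inclusion *m pull M *m inclusion^T = 0 by rewrite M0 mulmx0 mul0mx.
by rewrite /pull !mulmxA inclusionK mul1mx -mulmxA inclusionK mulmx1.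
Qed.

Lemma pullD M N : pull (M + N) = pull M + pull N.
Proof. by rewrite /pull mulmxDr mulmxDl. Qed.

Lemma pullN M : pull (- M) = - pull M.
Proof. by rewrite /pull mulmxN mulNmx. Qed.

Lemma pullZ x M : pull (x *: M) = x *: pull M.
Proof. by rewrite /pull -scalemxAr -scalemxAl. Qed.

Lemma pull_sprod a b : pull (sprod a b) = sprod (a *m inclusion) (b *m inclusion).
Proof. by rewrite pullZ pullD /pull /sprod !trmx_mul !mulmxA. Qed.

Lemma d5_inclusion j : d5 R j *m inclusion = delta_mx 0 (inord j.+1).
Proof.
rewrite /d5 -rowE; apply/rowP => i; rewrite mxE.
case: (ambient_indexP i) => [|l|]; rewrite /inclusion ?row_mxEl ?row_mxEr !mxE /= -!val_eqE /=
  inordK ?ltnS ?(ltnW (ltn_ord j)) //.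
  by rewrite add1n eqSS eq_sym.
by rewrite addn0 eqSS gtn_eqF.
Qed.

Lemma amb_dtE : amb_dt R 5 = delta_mx 0 (inord 0).
Proof.
rewrite /amb_dt; apply/rowP => i.
case: (ambient_indexP i) => [|l|]; rewrite ?row_mxEl ?row_mxEr !mxE /= -val_eqE /= inordK //.
Qed.

Lemma amb_drhoE : amb_drho R 5 = delta_mx 0 (inord 6).
Proof.
rewrite /amb_drho; apply/rowP => i.
case: (ambient_indexP i) => [|l|]; rewrite ?row_mxEl ?row_mxEr !mxE /= -val_eqE /= inordK //.
by rewrite add1n eqSS ltn_eqF.
Qed.

Lemma addmxE m n (M N : 'M[R]_(m, n)) i j : (M + N) i j = M i j + N i j.
Proof. by rewrite mxE. Qed.

Lemma oppmxE m n (M : 'M[R]_(m, n)) i j : (- M) i j = - M i j.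
Proof. by rewrite mxE. Qed.

Lemma scalemxE m n x (M : 'M[R]_(m, n)) i j : (x *: M) i j = x * M i j.
Proof. by rewrite mxE. Qed.

Lemma sprodE n (u v : 'rV[R]_n) i j :
  sprod u v i j = 2^-1 * (u 0 i * v 0 j + v 0 i * u 0 j).
Proof. by rewrite !mxE !big_ord1 !mxE. Qed.

Lemma scale_sprodE n x (u v : 'rV[R]_n) i j : (x *: sprod u v) i j = x * sprod u v i j.
Proof. by rewrite mxE. Qed.

Lemma sprodZl n x (u v : 'rV[R]_n) : sprod (x *: u) v = x *: sprod u v.
Proof. by apply/matrixP => i j; rewrite [RHS]mxE !sprodE !mxE; ring. Qed.

Lemma sprodC n (u v : 'rV[R]_n) : sprod u v = sprod v u.
Proof. by rewrite /sprod addrC. Qed.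

(** Both the correction to the metric and the Ricci tensor have this shape, so one independence
    lemma yields the initial conditions and the PDEs. *)
Definition theta1_theta4_form m x y z : 'M[R]_5 :=
  x *: sprod (theta1 m) (theta1 m) + (2 * y) *: sprod (theta1 m) (theta4 R)
  + z *: sprod (theta4 R) (theta4 R).

(** $\theta^1$ and $\theta^4$ are independent: the dy dy, dx dy and dx dx entries give x, y and z in
    turn. *)
Lemma theta1_theta4_form_eq0 m x y z : theta1_theta4_form m x y z = 0 ->
  [/\ x = 0, y = 0 & z = 0].
Proof.
move=> /matrixP form0.
have formE i j : x * (theta1 m 0 i * theta1 m 0 j)
    + y * (theta1 m 0 i * theta4 R 0 j + theta4 R 0 i * theta1 m 0 j)
    + z * (theta4 R 0 i * theta4 R 0 j) = 0.
  have := form0 i j; rewrite [X in _ = X]mxE => <-.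
  by rewrite /theta1_theta4_form !(addmxE, sprodE, scalemxE); field.
have t1x : theta1 m 0 ix = - m 0 ip by rewrite !mxE /=; ring.
have t1y : theta1 m 0 iy = 1 by rewrite !mxE /=; ring.
have t4x : theta4 R 0 ix = 3 by rewrite !mxE /=; ring.
have t4y : theta4 R 0 iy = 0 by rewrite !mxE /=; ring.
have x0 : x = 0 by rewrite -(formE iy iy) t1y t4y; ring.
have y0 : y = 0 by have := formE ix iy; rewrite t1x t1y t4x t4y x0; lra.
by have := formE ix ix; rewrite t1x t4x x0 y0; split=> //; lra.
Qed.

Definition sigma3 (m : 'rV[R]_5) : 'rV[R]_5 := d5 R ip - m 0 iq *: d5 R ix.

Lemma theta3E m : theta3 m = (2 * Num.sqrt 2) *: sigma3 m.
Proof. by []. Qed.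

Lemma sqrt2M : Num.sqrt 2 * Num.sqrt 2 = 2 :> R.
Proof. by rewrite -expr2 sqr_sqrtr. Qed.

Lemma theta2E f h (m : 'rV[R]_5) : theta2 f h m =
  d5 R iz - (m 0 iq ^+ 2 + f (xyp m) + h (xy m) * m 0 iz) *: d5 R ix
  - (2 * m 0 iq) *: sigma3 m.
Proof.
rewrite /theta2 theta3E scalerA; congr (_ - _ *: _).
transitivity (Num.sqrt 2 * Num.sqrt 2 * m 0 iq); last by rewrite sqrt2M.
by field.
Qed.

Lemma theta5E f h (m : 'rV[R]_5) : theta5 f h m =
  (2 * h (xy m)) *: sigma3 m - 6 *: d5 R iq
  + (3 * (2 * h (xy m) * m 0 iq + df_p f (xyp m))) *: d5 R ix
  + (1 / 10 * (9 * df_p (df_p f) (xyp m) + 4 * h (xy m) ^+ 2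
               - 6 * (m 0 ip * dh_y h (xy m) + dh_x h (xy m)))) *: theta1 m.
Proof.
rewrite /theta5 theta3E scalerA.
have -> : Num.sqrt 2 * h (xy m) / 2 * (2 * Num.sqrt 2)
    = Num.sqrt 2 * Num.sqrt 2 * h (xy m) by field.
by rewrite sqrt2M.
Qed.

Lemma sprod_theta3 (m : 'rV[R]_5) :
  sprod (theta3 m) (theta3 m) = 8 *: sprod (sigma3 m) (sigma3 m).
Proof.
rewrite theta3E sprodZl sprodC sprodZl scalerA; congr (_ *: _).
transitivity (4 * (Num.sqrt 2 * Num.sqrt 2) : R); first by ring.
by rewrite sqrt2M; ring.
Qed.

End Forms.

(** * The symbolic computation applied to the actual metric *)

Section Link.
Variables (R : realType) (U : set 'rV[R]_5) (W : set ('rV[R]_5 * R)).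
Variables (f : 'rV[R]_3 -> R) (h : 'rV[R]_2 -> R) (A B C : 'rV[R]_4 -> R).
Hypotheses (hUW : ambient_base U W)
    (hf : smooth_on (@xyp R @` U) f) (hh : smooth_on (@xy R @` U) h)
    (hA : smooth_on (@xypr R @` W) A) (hB : smooth_on (@xypr R @` W) B)
    (hC : smooth_on (@xypr R @` W) C).

Local Notation sel_xy := (@select R 6 [:: 1; 2]%N).
Local Notation sel_xyp := (@select R 6 [:: 1; 2; 4]%N).
Local Notation sel_xypr := (@select R 6 [:: 1; 2; 4; 6]%N).

(** The unknowns in the numbering of [dep]; the zero function fills the remaining indices. *)
Definition jet (k : nat) : 'rV[R]_7 -> R :=
  match k with
  | 0 => f \o sel_xyp | 1 => h \o sel_xy
  | 2 => A \o sel_xypr | 3 => B \o sel_xypr | 4 => C \o sel_xypr | _ => cst 0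
  end.

Local Notation dom := (ambient_dom W : set 'rV[R]_7).
Local Notation eval := (peval jet).
Local Notation G := (gtilde f h A B C : 'rV[R]_7 -> 'M[R]_7).

Let lt_xy : {in [:: 1; 2]%N, forall i, (i < 7)%N}.
Proof. exact/allP. Qed.

Let lt_xyp : {in [:: 1; 2; 4]%N, forall i, (i < 7)%N}.
Proof. exact/allP. Qed.

Let lt_xypr : {in [:: 1; 2; 4; 6]%N, forall i, (i < 7)%N}.
Proof. exact/allP. Qed.

Lemma jet_smooth k : smooth_on dom (jet k).
Proof.
have [_ _ _ WU] := hUW.
have inE (X : 'rV[R]_(1 + 5 + 1)) : dom X ->
    (@xyp R @` U) (sel_xyp X) /\ (@xy R @` U) (sel_xy X) /\ (@xypr R @` W) (sel_xypr X).
  move=> [_ WX]; rewrite -xyp_select -xy_select -xypr_select.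
  split; first by exists (amb_x X) => //; exact: WU WX.
  by split; [exists (amb_x X) => //; exact: WU WX | exists (amb_x X, amb_rho X)].
case: k => [|[|[|[|[|k]]]]] /=.
- by apply: (smooth_select _ lt_xyp hf) => // X /inE[].
- by apply: (smooth_select _ lt_xy hh) => // X /inE[_ []].
- by apply: (smooth_select _ lt_xypr hA) => // X /inE[_ []].
- by apply: (smooth_select _ lt_xypr hB) => // X /inE[_ []].
- by apply: (smooth_select _ lt_xypr hC) => // X /inE[_ []].
- exact: smooth_cst.
Qed.

Lemma jet_dep k s i X : i \notin dep k -> (i < 7)%N -> dom X ->
  partial (inord i) (foldr (@partial R 7) (jet k) s) X = 0.
Proof.
move=> ik i7 _; case: k ik => [|[|[|[|[|k]]]]] /= ik; try exact: foldr_partial_select_notin.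
by rewrite foldr_partial_cst0 /partial derive_cst.
Qed.

Lemma dom_coord0 (X : 'rV[R]_(1 + 5 + 1)) : dom X -> X 0 ord0 != 0.
Proof.
move=> [t0 _]; rewrite amb_tE in t0; rewrite (_ : ord0 = inord 0) ?lt0r_neq0 //.
by apply/val_inj; rewrite /= inordK.
Qed.

Let dom_open : open dom := open_ambient_dom hUW.

(** This and the next four lemmas convert ambient numbering into that of each function's own
    arguments: p, for instance, is ambient coordinate 4 but argument 2 of f. *)
Lemma partial_sel_p (F : 'rV[R]_3 -> R) :
  partial (inord 4) (F \o sel_xyp) = df_p F \o sel_xyp.
Proof. exact: (@partial_select_in R 6 [:: 1; 2; 4]%N isT lt_xyp F (@Ordinal 3 2 isT)). Qed.

Lemma partial_sel_hx (F : 'rV[R]_2 -> R) :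
  partial (inord 1) (F \o sel_xy) = dh_x F \o sel_xy.
Proof. exact: (@partial_select_in R 6 [:: 1; 2]%N isT lt_xy F (@Ordinal 2 0 isT)). Qed.

Lemma partial_sel_hy (F : 'rV[R]_2 -> R) :
  partial (inord 2) (F \o sel_xy) = dh_y F \o sel_xy.
Proof. exact: (@partial_select_in R 6 [:: 1; 2]%N isT lt_xy F (@Ordinal 2 1 isT)). Qed.

Lemma partial_sel_Ap (F : 'rV[R]_4 -> R) :
  partial (inord 4) (F \o sel_xypr) = dA_p F \o sel_xypr.
Proof. exact: (@partial_select_in R 6 [:: 1; 2; 4; 6]%N isT lt_xypr F (@Ordinal 4 2 isT)). Qed.

Lemma partial_sel_Arho (F : 'rV[R]_4 -> R) :
  partial (inord 6) (F \o sel_xypr) = dA_rho F \o sel_xypr.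
Proof. exact: (@partial_select_in R 6 [:: 1; 2; 4; 6]%N isT lt_xypr F (@Ordinal 4 3 isT)). Qed.

Definition partial_selE :=
  (partial_sel_p, partial_sel_hx, partial_sel_hy, partial_sel_Ap, partial_sel_Arho).

Lemma eval_mul p q X : dom X -> eval (p * q)%dP X = eval p X * eval q X.
Proof. exact: (peval_pmul _ dom_coord0). Qed.

Lemma eval_frac a b X : eval (pcst (frac a b.+1)) X = a%:~R / b.+1%:R.
Proof. by rewrite peval_pcst ofQ_frac. Qed.

Definition eval_form (a : form) X : 'rV[R]_7 := \row_i eval (nth [::] a i) X.

Lemma eval_combine s X : dom X ->
  eval_form (combine s) X = \sum_(pw <- s) eval pw.1 X *: eval_form pw.2 X.
Proof.
move=> dX; apply/rowP => i; rewrite mxE nth_mkseq // peval_psum big_map summxE.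
by apply: eq_bigr => -[p w] _; rewrite eval_mul // !mxE.
Qed.

Lemma eval_basis k X : (k < 7)%N -> eval_form (basisP k) X = delta_mx 0 (inord k).
Proof.
move=> k7; apply/rowP => i; rewrite !mxE nth_mkseq //= -val_eqE /= inordK //.
by case: eqP => _; rewrite ?eval_frac ?peval_nil // divr1.
Qed.

Lemma eval_sprod a b (i j : 'I_7) X : dom X ->
  eval (sprodP a b i j) X = sprod (eval_form a X) (eval_form b X) i j.
Proof.
move=> dX; rewrite sprodE !mxE !(eval_mul _ _ dX, peval_padd, eval_frac).
by rewrite div1r.
Qed.

Lemma eval_theta1 (X : 'rV[R]_(1 + 5 + 1)) : dom X ->
  eval_form theta1P X = theta1 (amb_x X) *m inclusion R.
Proof.
move=> dX; rewrite /theta1 mulmxBl -scalemxAl !d5_inclusion amb_xE /=.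
rewrite eval_combine // !big_cons big_nil addr0 !eval_basis //.
rewrite !(eval_mul _ _ dX, eval_frac, peval_patom) /=.
by apply/rowP => i; rewrite !(addmxE, scalemxE, oppmxE); field.
Qed.

Lemma eval_sigma (X : 'rV[R]_(1 + 5 + 1)) : dom X ->
  eval_form sigmaP X = sigma3 (amb_x X) *m inclusion R.
Proof.
move=> dX; rewrite /sigma3 mulmxBl -scalemxAl !d5_inclusion amb_xE /=.
rewrite eval_combine // !big_cons big_nil addr0 !eval_basis //.
rewrite !(eval_mul _ _ dX, eval_frac, peval_patom) /=.
by apply/rowP => i; rewrite !(addmxE, scalemxE, oppmxE); field.
Qed.

Lemma eval_theta4 (X : 'rV[R]_(1 + 5 + 1)) : dom X ->
  eval_form theta4P X = theta4 R *m inclusion R.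
Proof.
move=> dX; rewrite /theta4 -scalemxAl !d5_inclusion /=.
rewrite eval_combine // !big_cons big_nil addr0 !eval_basis //.
rewrite !(eval_mul _ _ dX, eval_frac, peval_patom) /=.
by apply/rowP => i; rewrite !(addmxE, scalemxE, oppmxE); field.
Qed.

Lemma eval_theta2 (X : 'rV[R]_(1 + 5 + 1)) : dom X ->
  eval_form theta2P X = theta2 f h (amb_x X) *m inclusion R.
Proof.
move=> dX; rewrite theta2E !mulmxBl -!scalemxAl !d5_inclusion -eval_sigma //.
rewrite xyp_select xy_select !amb_xE /=.
rewrite eval_combine // !big_cons big_nil addr0 !eval_basis //.
rewrite !(eval_mul _ _ dX, peval_padd, eval_frac, peval_patom) /=.
by apply/rowP => i; rewrite !(addmxE, scalemxE, oppmxE); field.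
Qed.

Lemma eval_theta5 (X : 'rV[R]_(1 + 5 + 1)) : dom X ->
  eval_form theta5P X = theta5 f h (amb_x X) *m inclusion R.
Proof.
move=> dX; rewrite theta5E !(mulmxDl, mulNmx) -!scalemxAl !d5_inclusion.
rewrite -eval_sigma // -eval_theta1 //.
rewrite xyp_select xy_select !amb_xE /=.
rewrite eval_combine // !big_cons big_nil addr0 !eval_basis //.
rewrite !(eval_mul _ _ dX, peval_padd, eval_frac, peval_patom) /= !partial_selE.
by apply/rowP => i; rewrite !(addmxE, scalemxE, oppmxE) /=; field.
Qed.

Lemma eval_metric (X : 'rV[R]_(1 + 5 + 1)) (i j : 'I_7) : dom X ->
  G X i j = eval (metricP i j) X.
Proof.
move=> dX; rewrite /metricP.
rewrite !(eval_sprod _ _ _ _ dX, eval_mul _ _ dX, peval_padd, eval_frac, peval_patom) /=.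
rewrite !(eval_theta1, eval_theta2, eval_sigma, eval_theta4, eval_theta5) //.
rewrite eval_combine // !big_cons big_nil addr0 !eval_basis //.
rewrite !(eval_frac, peval_patom) /=.
rewrite /gtilde /ambient_form /gD sprod_theta3 amb_pullE !(pullD, pullN, pull_sprod, pullZ).
rewrite amb_dtE amb_drhoE xypr_select amb_tE amb_rhoE.
(* With the seven symmetric products made opaque, the identity is linear in their entries. *)
do 7![move: (sprod _ _) => ?].
by rewrite !(addmxE, oppmxE, scalemxE); field.
Qed.

Lemma equalP_eval n p q (i j : nat) X : equalP n p q -> (i < n)%N -> (j < n)%N -> dom X ->
  eval (p i j) X = eval (q i j) X.
Proof.
move=> pq i_n j_n dX; apply/eqP; rewrite -subr_eq0; apply/eqP.
have /allP/(_ i) := pq; rewrite mem_iota => /(_ i_n)/allP/(_ j).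
rewrite mem_iota => /(_ j_n); case E : (p i j - q i j)%dP => // _.
have := peval_nil jet X; rewrite -E peval_padd eval_mul // eval_frac => <-.
by field.
Qed.

Lemma eval_psum_mkseq n (p : nat -> dpoly) X :
  eval (psum [seq p k | k <- iota 0 n]) X = \sum_(k < n) eval (p k) X.
Proof. by rewrite peval_psum big_map -[in LHS](subn0 n) big_mkord. Qed.

Lemma mulG (X : 'rV[R]_(1 + 5 + 1)) : dom X ->
  G X *m \matrix_(i, j) eval (inverseP i j) X = 1%:M.
Proof.
move=> dX; apply/matrixP => i j; rewrite [LHS]mxE [RHS]mxE.
transitivity (eval (if i == j :> nat then pcst (frac 1 1) else [::]) X).
  rewrite -(equalP_eval metricPK) // eval_psum_mkseq.
  apply: eq_bigr => k _; rewrite eval_mul // -eval_metric //.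
  by congr (_ * _); rewrite mxE.
by rewrite -val_eqE; case: eqVneq => _; rewrite ?eval_frac ?peval_nil ?divr1.
Qed.

Lemma G_unit (X : 'rV[R]_(1 + 5 + 1)) : dom X -> G X \in unitmx.
Proof. by move=> /mulG/mulmx1_unit[]. Qed.

(** For square matrices a right inverse is the inverse. *)
Lemma eval_inverse (X : 'rV[R]_(1 + 5 + 1)) (i j : 'I_7) : dom X ->
  invmx (G X) i j = eval (inverseP i j) X.
Proof.
move=> dX; rewrite -[invmx _]mulmx1 -(mulG dX) mulKmx ?G_unit //.
by rewrite mxE.
Qed.

Lemma eval_ricci (X : 'rV[R]_(1 + 5 + 1)) (i j : 'I_7) : dom X ->
  ricci G X i j = eval (residualP i j) X.
Proof.
move=> dX; rewrite -(equalP_eval ricciP_residual) //.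
apply: (represents_ricci dom_open dom_coord0 jet_smooth jet_dep) => //.
  by move=> k l Y dY; rewrite memo2E // eval_metric.
by move=> k l Y dY; rewrite memo2E // eval_inverse.
Qed.

(** [resA], [resB], [resC] are the differences E_A, E_B, E_C as functions on the ambient space. *)
Definition resA (X : 'rV[R]_(1 + 5 + 1)) : R := let v := xypr (amb_x X, amb_rho X) in
  Lop A v - 9 / 40 * df_p (df_p (df_p (df_p f))) (xyp (amb_x X)).

Definition resB (X : 'rV[R]_(1 + 5 + 1)) : R :=
  let m := amb_x X in let v := xypr (m, amb_rho X) in
  Lop B v - (- (1 / 36) * dA_p A v + 3 / 40 * df_p (df_p (df_p f)) (xyp m)
             + 9 / 20 * dh_y h (xy m)).

Definition resC (X : 'rV[R]_(1 + 5 + 1)) : R :=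
  let m := amb_x X in let v := xypr (m, amb_rho X) in
  Lop C v - (- (1 / 18) * dA_p B v + 1 / 324 * A v
             + 1 / 30 * df_p (df_p f) (xyp m) - 2 / 15 * h (xy m) ^+ 2
             + 1 / 5 * (m 0 ip * dh_y h (xy m) + dh_x h (xy m))).

Lemma select_rho X : sel_xypr X 0 (@Ordinal 4 3 isT) = X 0 (inord 6).
Proof. by rewrite mxE. Qed.

Lemma eval_residualA (X : 'rV[R]_(1 + 5 + 1)) : dom X -> eval residualA X = resA X.
Proof.
move=> dX; rewrite /residualA /boxP /resA /Lop xypr_select xyp_select /=.
rewrite !(eval_mul _ _ dX, peval_padd, eval_frac, peval_patom) /=.
rewrite (partial_sel_p f) (partial_sel_p (df_p f)) (partial_sel_p (df_p (df_p f))).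
rewrite (partial_sel_p (df_p (df_p (df_p f)))) !(partial_sel_Ap, partial_sel_Arho) /=.
by rewrite select_rho; field.
Qed.

Lemma eval_residualB (X : 'rV[R]_(1 + 5 + 1)) : dom X -> eval residualB X = resB X.
Proof.
move=> dX; rewrite /residualB /boxP /resB /Lop xypr_select xyp_select xy_select /=.
rewrite !(eval_mul _ _ dX, peval_padd, eval_frac, peval_patom) /= !partial_selE /=.
by rewrite select_rho; field.
Qed.

Lemma eval_residualC (X : 'rV[R]_(1 + 5 + 1)) : dom X -> eval residualC X = resC X.
Proof.
move=> dX; rewrite /residualC /boxP /resC /Lop xypr_select xyp_select xy_select amb_xE /=.
rewrite !(eval_mul _ _ dX, peval_padd, eval_frac, peval_patom) /= !partial_selE /=.
by rewrite select_rho; field.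
Qed.

Lemma ricci_gtilde (X : 'rV[R]_(1 + 5 + 1)) : dom X ->
  ricci G X = 2^-1 *: pull (theta1_theta4_form (amb_x X) (resA X) (resB X) (resC X)).
Proof.
move=> dX; apply/matrixP => i j; rewrite eval_ricci // /residualP.
rewrite -eval_residualA // -eval_residualB // -eval_residualC //.
(* Abstracting the residuals keeps the rewriting below from expanding them. *)
move: residualA residualB residualC => rA rB rC.
rewrite !(eval_sprod _ _ _ _ dX, eval_mul _ _ dX, peval_padd, eval_frac) /=.
rewrite !(eval_theta1, eval_theta4) //.
rewrite /theta1_theta4_form !(pullD, pull_sprod, pullZ).
do 3![move: (sprod _ _) => ?].
by rewrite !(addmxE, scalemxE); field.
Qed.

Lemma G_metric : metric_on dom G.
Proof.
split=> [i j|X dX].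
  apply: (represents_smooth dom_open dom_coord0 jet_smooth jet_dep (p := metricP i j)).
  by move=> X dX; exact: eval_metric.
split; last exact: G_unit.
apply/matrixP => i j; rewrite mxE !eval_metric //.
by rewrite (equalP_eval metricP_sym).
Qed.

End Link.

(** * Restriction to t = 1, and the equivalence with the PDE system *)

Section AmbientPoint.
Variable R : realType.
Implicit Types (m : 'rV[R]_5) (W : set ('rV[R]_5 * R)).

Definition ambient_point m (rho : R) : 'rV[R]_(1 + 5 + 1) := row_mx (row_mx 1%:M m) rho%:M.

Lemma ambient_pointE m rho :
  [/\ amb_t (ambient_point m rho) = 1, amb_x (ambient_point m rho) = m
    & amb_rho (ambient_point m rho) = rho].
Proof.
rewrite /amb_t /amb_x /amb_rho /ambient_point row_mxKl row_mxKl row_mxKr row_mxKr.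
by split=> //; rewrite mxE.
Qed.

Lemma ambient_point_dom W m rho : W (m, rho) -> ambient_dom W (ambient_point m rho).
Proof. by have [t x r] := ambient_pointE m rho; rewrite /ambient_dom /= t x r. Qed.

(** At t = 1 the two forms share the part in dt and drho, and what remains is an injective
    pull-back. *)
Lemma ambient_form_inj (g1 g2 : 'rV[R]_5 -> R -> 'M[R]_5) m rho :
  ambient_form g1 (ambient_point m rho) = ambient_form g2 (ambient_point m rho) ->
  g1 m rho = g2 m rho.
Proof.
have [t x r] := ambient_pointE m rho.
rewrite /ambient_form t x r expr1n !scale1r !amb_pullE => /addrI/eqP.
rewrite -subr_eq0 -pullN -pullD => /eqP/pull_inj/eqP.
by rewrite subr_eq0 => /eqP.
Qed.

(** $\theta^1$ and $\theta^4$ have no dp component, so only $(\theta^3)^2=8\sigma^2$ contributes. *)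
Lemma gD_pp f h m : gD f h m ip ip = 8.
Proof.
have t1 : theta1 m 0 ip = 0 by rewrite !mxE /=; ring.
have t4 : theta4 R 0 ip = 0 by rewrite !mxE /=; ring.
have s3 : sigma3 m 0 ip = 1 by rewrite !mxE /=; ring.
rewrite /gD sprod_theta3 !(addmxE, oppmxE, scale_sprodE) !sprodE t1 t4 s3.
by field.
Qed.

Lemma theta1_theta4_form_pp m x y z : theta1_theta4_form m x y z ip ip = 0.
Proof.
have t1 : theta1 m 0 ip = 0 by rewrite !mxE /=; ring.
have t4 : theta4 R 0 ip = 0 by rewrite !mxE /=; ring.
rewrite /theta1_theta4_form !(addmxE, scale_sprodE) !sprodE t1 t4.
by field.
Qed.

End AmbientPoint.

Theorem theorem3p1 (R : realType) (U : set 'rV[R]_5) (W : set ('rV[R]_5 * R))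
    (f : 'rV[R]_3 -> R) (h : 'rV[R]_2 -> R) (A B C : 'rV[R]_4 -> R)
    (hUW : ambient_base U W)
    (hf : smooth_on (@xyp R @` U) f) (hh : smooth_on (@xy R @` U) h)
    (hA : smooth_on (@xypr R @` W) A) (hB : smooth_on (@xypr R @` W) B)
    (hC : smooth_on (@xypr R @` W) C) :
  ambient_metric_class U W (gD f h) (gtilde f h A B C) <->
  (forall m, U m ->
     [/\ A (xypr (m, 0)) = 0, B (xypr (m, 0)) = 0 & C (xypr (m, 0)) = 0]) /\
  (forall m rho, W (m, rho) ->
     let v := xypr (m, rho) in
     [/\ Lop A v = 9 / 40 * df_p (df_p (df_p (df_p f))) (xyp m),
         Lop B v = - (1 / 36) * dA_p A v
                   + 3 / 40 * df_p (df_p (df_p f)) (xyp m)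
                   + 9 / 20 * dh_y h (xy m)
       & Lop C v = - (1 / 18) * dA_p B v + 1 / 324 * A v
                   + 1 / 30 * df_p (df_p f) (xyp m)
                   - 2 / 15 * h (xy m) ^+ 2
                   + 1 / 5 * (m 0 ip * dh_y h (xy m) + dh_x h (xy m))]).
Proof.
have [_ _ UW _] := hUW.
have ricciE := ricci_gtilde hUW hf hh hA hB hC.
split=> [[g' [[u [_ _ g'E]] [_ _ [g [gtE gE]] ric0]]]|[init pde]].
  split=> [m Um|m rho Wm /=].
    (* Comparing the two expressions of the metric at t = 1, rho = 0 gives $g_{\mathcal D_{f,h}}$
       plus the correction equal to $u\,g_{\mathcal D_{f,h}}$. *)
    have := gtE _ (ambient_point_dom (UW _ Um)).
    move=> /(@ambient_form_inj R).
    rewrite gE // g'E // => gDE.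
    have form0 : (1 - u m) *: gD f h m
        + theta1_theta4_form m (A (xypr (m, 0))) (B (xypr (m, 0))) (C (xypr (m, 0))) = 0.
      have -> : theta1_theta4_form m (A (xypr (m, 0))) (B (xypr (m, 0))) (C (xypr (m, 0)))
          = u m *: gD f h m - gD f h m.
        rewrite -gDE /theta1_theta4_form; move: (gD f h m) => g0.
        by rewrite -!addrA [RHS]addrC !addrA subrK.
      by rewrite scalerBl scale1r addrA subrK subrr.
    (* The dp dp entry reads 8 (1 - u) = 0. *)
    have u1 : 1 - u m = 0.
      have /matrixP/(_ ip ip) := form0.
      rewrite addmxE scalemxE gD_pp theta1_theta4_form_pp mxE => h0; lra.
    by apply: (@theta1_theta4_form_eq0 R m); rewrite -form0 u1 scale0r add0r.
  have dX := ambient_point_dom Wm.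
  (* Ricci-flatness at t = 1 suffices, because the residuals depend only on the base point and
     rho. *)
  have := ric0 _ dX; rewrite ricciE // => /eqP.
  rewrite scaler_eq0 invr_eq0 pnatr_eq0 /= => /eqP/pull_inj/theta1_theta4_form_eq0.
  rewrite /resA /resB /resC; have [_ -> ->] := ambient_pointE m rho.
  by move=> [/subr0_eq-> /subr0_eq-> /subr0_eq->].
(* For the converse the representative is $g_{\mathcal D_{f,h}}$ itself, with conformal factor 1. *)
exists (gD f h); split.
  exists (cst 1); split=> [|//|x _]; first exact: smooth_cst.
  by rewrite scale1r.
split=> //.
- exact: (G_metric hUW hf hh hA hB hC).
(* The family g(x, rho) is read off from the definition of [gtilde] by unification. *)
- eexists; split=> [X _|m Um]; first by rewrite /gtilde.
  have [-> -> ->] := init m Um.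
  by rewrite mulr0 !scale0r !addr0.
- move=> X dX; rewrite ricciE //.
  have [rA rB rC] := pde _ _ dX.2.
  rewrite /resA /resB /resC rA rB rC !subrr /theta1_theta4_form.
  by rewrite mulr0 !scale0r !addr0 /pull mulmx0 mul0mx scaler0.
Qed.
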